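(* Let $\theta(n)$ denote the maximum interval colouring thickness of a graph on $n$ vertices and $\theta'(m)$ the maximum interval colouring thickness of a graph with $m$ edges. Then $\theta(n)\le n^{5/6+o(1)}$ as $n\to\infty$ and $\theta'(m)\le m^{5/11+o(1)}$ as $m\to\infty$.
   Context: All graphs are finite and simple. An interval colouring of a graph $G$ is a proper edge-colouring $c\colon E(G)\to\mathbb{N}$ such that for every vertex $v$, the set $\{c(vw): w\in N(v)\}$ of colours on edges incident to $v$ is a set of consecutive integers. $G$ is interval colourable if it has an interval colouring. The interval colouring thickness $\theta(G)$ is the minimum $k$ such that $E(G)$ can be partitioned into $k$ sets each spanning an interval colourable subgraph. *)

(* Defs.v *)
From mathcomp Require Import all_boot.
From Stdlib Require Import ClassicalEpsilon.

Set Implicit Arguments.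
Unset Strict Implicit.
Unset Printing Implicit Defensive.

Section IntervalColouring.
Variable T : finType.

Definition simple_graph (e : rel T) : Prop := symmetric e /\ irreflexive e.

Definition edge_set (e : rel T) : {set {set T}} :=
  [set [set x; y] | x in T, y in T & e x y].

(* An edge colouring c : E(G) -> N, represented on ordered pairs and
   required to be symmetric on edges. *)
Definition proper_edge_colouring (e : rel T) (c : T -> T -> nat) : Prop :=
  (forall x y, e x y -> c x y = c y x) /\
  (forall v w1 w2, e v w1 -> e v w2 -> w1 != w2 -> c v w1 != c v w2).

Definition colours_at (e : rel T) (c : T -> T -> nat) (v : T) : seq nat :=
  [seq c v w | w <- enum T & e v w].

Definition consecutive (s : seq nat) : Prop :=
  forall a b k, a \in s -> b \in s -> a <= k <= b -> k \in s.

Definition interval_colouring (e : rel T) (c : T -> T -> nat) : Prop :=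
  proper_edge_colouring e c /\ forall v, consecutive (colours_at e c v).

Definition interval_colourable (e : rel T) : Prop :=
  exists c, interval_colouring e c.

(* A partition of E(G) into k classes (indexed by 'I_k, classes may be
   empty, which does not change the minimum) each spanning an interval
   colourable subgraph. *)
Definition icol_partition (e : rel T) (k : nat) (p : T -> T -> 'I_k) : Prop :=
  (forall x y, e x y -> p x y = p y x) /\
  (forall i : 'I_k, interval_colourable [rel x y | e x y && (p x y == i)]).

Definition has_icol_partition (e : rel T) (k : nat) : Prop :=
  exists p : T -> T -> 'I_k, icol_partition e p.

Definition asb (P : Prop) : bool :=
  if excluded_middle_informative P then true else false.

Lemma asbP (P : Prop) : reflect P (asb P).
Proof. by rewrite /asb; case: excluded_middle_informative => h; constructor. Qed.

(* Every graph admits such a partition (one class per edge). *)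
Lemma has_icol_partition_ex (e : rel T) :
  exists k, asb (has_icol_partition e k).
Proof.
exists #|{set T}|; apply/asbP.
exists (fun x y => enum_rank [set x; y]); split.
  by move=> x y _; rewrite setUC.
move=> i; exists (fun _ _ => 0); split; last first.
  move=> v a b k; rewrite /colours_at => /mapP[w hw ->] /mapP[w' _ ->].
  by rewrite leqn0 => /andP[_ /eqP ->]; apply/mapP; exists w.
split=> // v w1 w2 /= /andP[_ /eqP h1] /andP[_ /eqP h2] hne.
exfalso; move: h2; rewrite -h1 => /enum_rank_inj h; symmetry in h.
have : w1 \in [set v; w2] by rewrite -h !inE eqxx orbT.
rewrite !inE (negPf hne) orbF => /eqP hv; subst w1.
have : w2 \in [set v; v] by rewrite h !inE eqxx orbT.
by rewrite !inE orbb eq_sym (negPf hne).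
Qed.

Definition thickness (e : rel T) : nat := ex_minn (has_icol_partition_ex e).

End IntervalColouring.

(* Main.v *)
Require Import Defs.
From mathcomp Require Import all_boot zify.
From Stdlib Require Import Reals Lra.
From mathcomp Require Import ssrnat.

(** In a bipartite graph whose larger side has minimum degree [d], successive
    perfect matchings between nested vertex sets (Pyber's argument for regular
    subgraphs) form an interval colourable subgraph with at least [d^2 / 2]
    edges.  Remove such subgraphs until the graph is [O(t)]-degenerate; each
    has order [t^2] edges, so a graph with at most [t^3] edges allows
    [O(t)] removals, and what is left splits into [O(t)] forests, which are
    interval colourable.  Hence the thickness is [O(m^(1/3))], and therefore
    [O(n^(2/3))]; both exponents are below the required ones. *)

Set Implicit Arguments.
Unset Strict Implicit.
Unset Printing Implicit Defensive.

(** * Interval colourable subgraphs and partitions of the edge set *)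

Section Colourings.
Variable T : finType.
Implicit Types (e f g h : rel T) (c : T -> T -> nat) (S U X A : {set T}).

Lemma mem_colours_at e c v a :
  reflect (exists2 w, e v w & c v w = a) (a \in colours_at e c v).
Proof.
apply: (iffP mapP) => [[w + ->]|[w evw <-]].
  by rewrite mem_filter => /andP[evw _]; exists w.
by exists w; rewrite // mem_filter evw mem_enum.
Qed.

Lemma eq_interval_colourable e f :
  e =2 f -> interval_colourable e -> interval_colourable f.
Proof.
move=> eqef [c [[csym cinj] ccons]]; exists c; split; first split.
- by move=> x y; rewrite -eqef; apply: csym.
- by move=> v w1 w2; rewrite -!eqef; apply: cinj.
move=> v a b k /mem_colours_at[w fw wa] /mem_colours_at[w' fw' wb] akb.
have ea : a \in colours_at e c v by apply/mem_colours_at; exists w; rewrite ?eqef.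
have eb : b \in colours_at e c v by apply/mem_colours_at; exists w'; rewrite ?eqef.
have /mem_colours_at[u eu uk] := ccons v a b k ea eb akb.
by apply/mem_colours_at; exists u; rewrite -?eqef.
Qed.

Lemma thickness_leq e k : has_icol_partition e k -> thickness e <= k.
Proof.
by move=> ek; rewrite /thickness; case: ex_minnP => m _; apply; apply/asbP.
Qed.

(** The edges of [f] become the new class [ord0], and [lift ord0] shifts the classes of the
    remaining graph. *)
Lemma has_icol_partitionS e f k :
    symmetric f -> (forall x y, f x y -> e x y) -> interval_colourable f ->
    has_icol_partition [rel x y | e x y && ~~ f x y] k ->
  has_icol_partition e k.+1.
Proof.
move=> fsym fe fcol [p [psym pcol]].
exists (fun x y => if f x y then ord0 else lift ord0 (p x y)); split.
  move=> x y exy; rewrite [f y x]fsym; case: ifPn => // nf.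
  by rewrite psym //= exy nf.
move=> i; case: (unliftP ord0 i) => [j|] ->.
  apply: eq_interval_colourable (pcol j) => x y /=; case: (f x y).
    by rewrite (negPf (neq_lift _ _)) !andbF.
  by rewrite andbT (inj_eq lift_inj).
apply: eq_interval_colourable fcol => x y /=; case: ifPn => [fxy|nf].
  by rewrite eqxx (fe _ _ fxy).
by rewrite eq_sym (negPf (neq_lift _ _)) andbF.
Qed.

(** Edges are counted as ordered pairs: twice for a simple graph, once for a relation oriented
    across a bipartition. *)
Definition arcs e : {set T * T} := [set p | e p.1 p.2].

(** An ordered pair is determined by its underlying set and one bit comparing the enumeration ranks
    of its ends. *)
Lemma card_arcs_edge_set e : #|arcs e| <= 2 * #|edge_set e|.
Proof.
pose phi (p : T * T) := ([set p.1; p.2], enum_rank p.1 < enum_rank p.2).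
have phi_inj : injective phi.
  move=> [x y] [x' y'] [/= eqs eqr].
  have: x \in [set x'; y'] by rewrite -eqs !inE eqxx.
  have: y \in [set x'; y'] by rewrite -eqs !inE eqxx orbT.
  have: x' \in [set x; y] by rewrite eqs !inE eqxx.
  have: y' \in [set x; y] by rewrite eqs !inE eqxx orbT.
  rewrite !inE => y'xy x'xy yxy' xxy'.
  have [xx'|nxx'] := eqVneq x x'.
    subst x'; case/orP: y'xy => [/eqP y'x|/eqP ->//].
    by move: yxy'; rewrite y'x orbb => /eqP ->.
  move: xxy' x'xy; rewrite [x' == x]eq_sym (negPf nxx') /= => /eqP xy' /eqP yx'.
  subst x y; move: nxx'; rewrite -(inj_eq enum_rank_inj) -val_eqE /=.
  by move: eqr; case: ltngtP.
rewrite mulnC -card_bool -cardsT -cardsX -(card_imset _ phi_inj).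
apply/subset_leq_card/subsetP => _ /imsetP[[x y] + ->]; rewrite inE => /= exy.
by rewrite !inE andbT; apply/imset2P; exists x y; rewrite ?inE.
Qed.

Lemma card_arcs_sub e f :
    (forall x y, f x y -> e x y) ->
  #|arcs [rel x y | e x y && ~~ f x y]| + #|arcs f| = #|arcs e|.
Proof.
move=> fe; rewrite -(cardsID (arcs f) (arcs e)) addnC; congr (_ + _).
  by apply: eq_card => p; rewrite !inE; case: (boolP (f _ _)) => [/fe ->|];
    rewrite ?andbF.
by apply: eq_card => p; rewrite !inE /= andbC.
Qed.

(** * Interval colouring of forests *)

Section Forests.
Variables (f : rel T) (rho : T -> nat).
Hypothesis fsym : symmetric f.
Hypothesis rho_neq : forall x y, f x y -> rho x != rho y.
Hypothesis parent_uniq : forall x y z,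
  f x y -> f x z -> rho y < rho x -> rho z < rho x -> y = z.

Let children p := [seq w <- enum T | f p w & rho p < rho w].

(* [fcol n x] is the colour of the edge from [x] to its parent, with fuel [n]. *)
Let fcol := fix fcol n x := if n is n'.+1 then
  (if [pick y | f x y & rho y < rho x] is Some p
   then fcol n' p + 1 + index x (children p) else 0) else 0.

Let fcol_fuel n m x : rho x < n -> rho x < m -> fcol n x = fcol m x.
Proof.
elim: n m x => // n IHn [|m] x //= xn xm; case: pickP => // p /andP[_ px].
by rewrite (IHn m) //; lia.
Qed.

(** The neighbour of lower rank is the parent. Colours spread outwards from the roots: [col v] goes
    to the edge from [v] to its parent, and the edges to its children get [col v + 1], [col v + 2]
    and so on, in the order of [children v]. *)
Lemma forest_interval_colourable : interval_colourable f.
Proof.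
pose col x := fcol (rho x).+1 x.
have colE x y : f x y -> rho y < rho x ->
    col x = col y + 1 + index x (children y).
  move=> fxy yx; rewrite /col /=; case: pickP => [p /andP[fxp px]|/(_ y)].
    rewrite (parent_uniq fxy fxp yx px).
    by rewrite (fcol_fuel (m := (rho p).+1)).
  by rewrite fxy yx.
have mem_children p w : (w \in children p) = f p w && (rho p < rho w).
  by rewrite mem_filter mem_enum andbT.
pose c x y := if rho y < rho x then col x else col y.
have lt_rho x y : f x y -> (rho x < rho y) = ~~ (rho y < rho x).
  by move=> /rho_neq; case: ltngtP.
have c_ge v w : f v w -> col v <= c v w.
  move=> fvw; rewrite /c; case: ifPn => // nwv.
  by rewrite (colE w v) 1?fsym // 1?lt_rho // -?addnA ?leq_addr.
exists c; split; first split.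
- move=> x y fxy; by rewrite /c (lt_rho x y) //; case: ltnP.
- move=> v w1 w2 f1 f2 ne; rewrite /c.
  case: ifPn => h1; case: ifPn => h2.
  + by rewrite (parent_uniq f1 f2 h1 h2) eqxx in ne.
  + by rewrite (colE w2 v) 1?fsym // 1?lt_rho //; lia.
  + by rewrite (colE w1 v) 1?fsym // 1?lt_rho //; lia.
  rewrite -lt_rho // in h1; rewrite -lt_rho // in h2.
  rewrite (colE w1 v) 1?fsym // (colE w2 v) 1?fsym //.
  rewrite eqn_add2l; apply: contra ne => /eqP eqi; apply/eqP.
  have m1 : w1 \in children v by rewrite mem_children f1.
  have m2 : w2 \in children v by rewrite mem_children f2.
  by rewrite -(nth_index v m1) eqi nth_index.
move=> v a b k /mem_colours_at[w fw <-] /mem_colours_at[w' fw' <-] /andP[ak kb].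
have [<-|ne_ak] := eqVneq (c v w) k; first by apply/mem_colours_at; exists w.
have lt_k : col v < k by rewrite (leq_ltn_trans (c_ge _ _ fw)) // ltn_neqAle ne_ak.
(* If [w'] were the parent of [v], its edge would have colour [col v], below [k]. So [w'] is a
   child, and [k] is the colour of the edge to the child of index [k - (col v + 1)]. *)
have [vw'|] := boolP (rho v < rho w'); last first.
  rewrite lt_rho // negbK => w'v; move: kb; rewrite /c w'v; lia.
have : w' \in children v by rewrite mem_children fw'.
rewrite -index_mem => sz.
move: kb; rewrite {1}/c ltnNge (ltnW vw') /= (colE w' v) 1?fsym // => kb.
have ks : k - (col v + 1) < size (children v).
  by move: sz kb lt_k; move: (index _ _) (size _) (col v); clear; lia.
have := mem_nth v ks; rewrite mem_children => /andP[fu vu].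
apply/mem_colours_at; exists (nth v (children v) (k - (col v + 1))) => //.
rewrite /c ltnNge (ltnW vu) /= (colE _ v) 1?fsym // index_uniq //.
  by rewrite subnKC // addn1.
by rewrite filter_uniq ?enum_uniq.
Qed.

End Forests.

(** * Degenerate graphs split into forests *)

Definition degenerate e k :=
  forall U, U != set0 -> exists2 v, v \in U & #|[set w in U | e v w]| < k.

(** Remove a vertex with fewer than [k] neighbours in the current set, rank the rest recursively,
    and give the removed vertex the top rank. *)
Lemma degenerate_rank e k : degenerate e k ->
  exists2 rho : T -> nat, injective rho &
    forall v, #|[set w | e v w & rho w < rho v]| < k.
Proof.
move=> deg.
suff [rho [_ rinj rk]] : exists rho : T -> nat,
    [/\ forall x, x \in [set: T] -> rho x < #|[set: T]|,
        {in [set: T] &, injective rho} &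
        forall v, v \in [set: T] ->
          #|[set w in [set: T] | e v w & rho w < rho v]| < k].
  exists rho => [x y|v]; first by apply: rinj; rewrite inE.
  by have := rk v (in_setT v); congr (_ < k); apply: eq_card => w; rewrite !inE.
move: [set: T] => U; move: {2}#|U| (leqnn #|U|) => n; elim: n U => [|n IHn] U.
  rewrite leqn0 cards_eq0 => /eqP ->; exists (fun=> 0).
  by split => x; rewrite inE.
move=> Un; have [->|/deg[v vU vk]] := eqVneq U set0.
  by exists (fun=> 0); split => x; rewrite inE.
have cU := cardsD1 v U; rewrite vU add1n in cU.
have [|rho [rlt rinj rk]] := IHn (U :\ v); first by rewrite -ltnS -cU.
exists (fun x => if x == v then #|U :\ v| else rho x).
have rltU x : x \in U -> x != v -> rho x < #|U :\ v|.
  by move=> xU xv; apply: rlt; rewrite !inE xv.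
split.
- move=> x xU; case: eqVneq => [_|xv]; first by rewrite cU.
  by rewrite cU ltnW // ltnS rltU.
- move=> x y xU yU; case: (eqVneq x v) => xv; case: (eqVneq y v) => yv.
  + by rewrite xv yv.
  + by have := rltU _ yU yv; lia.
  + by have := rltU _ xU xv; lia.
  by apply: rinj; rewrite !inE ?xv ?yv.
move=> x xU; case: (eqVneq x v) => [->|xv].
  apply: leq_ltn_trans vk; apply/subset_leq_card/subsetP => w.
  by rewrite !inE => /and3P[-> ->].
have xU' : x \in U :\ v by rewrite !inE xv.
apply: leq_ltn_trans (rk x xU'); apply/subset_leq_card/subsetP => w.
rewrite !inE => /and3P[-> ->]; case: eqVneq => //= _.
by have := rltU _ xU xv; lia.
Qed.

(** The edges from a vertex to its neighbours of lower rank get distinct labels, so within one label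
    every vertex has at most one parent and the class is a forest. *)
Lemma degenerate_icol_partition e k : 0 < k ->
  symmetric e -> irreflexive e -> degenerate e k -> has_icol_partition e k.
Proof.
case: k => // k _ eC eirr /degenerate_rank[rho rinj rk].
pose back x := enum [set w | e x w & rho w < rho x].
have mem_back x w : (w \in back x) = e x w && (rho w < rho x).
  by rewrite mem_enum inE.
have sz_back x : size (back x) <= k.+1 by rewrite -cardE ltnW.
pose lab x y : 'I_k.+1 := inord (index y (back x)).
have lab_inj x y z : y \in back x -> z \in back x ->
    lab x y = lab x z -> y = z.
  move=> yx zx /(congr1 val); rewrite /= !inordK.
  - by move=> eqi; rewrite -(nth_index x yx) eqi nth_index.
  - by apply: leq_trans (sz_back x); rewrite index_mem.
  - by apply: leq_trans (sz_back x); rewrite index_mem.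
have rne x y : e x y -> rho x != rho y.
  by move=> exy; apply: contraTneq exy => /rinj ->; rewrite eirr.
exists (fun x y => if rho y < rho x then lab x y else lab y x); split.
  by move=> x y /rne; case: ltngtP.
move=> i; apply: (forest_interval_colourable (rho := rho)).
- move=> x y /=; rewrite eC; have [/rne|//] := boolP (e y x).
  by case: ltngtP.
- by move=> x y /andP[/rne].
move=> x y z /= /andP[exy /eqP +] /andP[exz /eqP +] yx zx.
rewrite yx zx => <- /esym; apply: lab_inj; by rewrite mem_back ?exy ?exz.
Qed.

(** * Hall's theorem and nested matchings *)

Definition nbhd g X := [set y | [exists x in X, g x y]].

Lemma nbhdP g X y : reflect (exists2 x, x \in X & g x y) (y \in nbhd g X).
Proof. by rewrite inE; apply: exists_inP. Qed.

Lemma nbhdS g X S : S \subset X -> nbhd g S \subset nbhd g X.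
Proof.
move=> /subsetP sSX; apply/subsetP => y /nbhdP[x xS gxy].
by apply/nbhdP; exists x; rewrite ?sSX.
Qed.

(** Induction on the size of [X]. If some nonempty proper subset [S] is tight, match [S] and
    [X :\: S] separately, the latter outside [nbhd g S]. Otherwise any edge at any vertex can be
    fixed. *)
Lemma hall g X : (forall S, S \subset X -> #|S| <= #|nbhd g S|) ->
  exists2 phi : T -> T, {in X &, injective phi} & {in X, forall x, g x (phi x)}.
Proof.
move: {2}#|X| (leqnn #|X|) => n; elim: n X g => [|n IHn] X g Xn hallX.
  move: Xn; rewrite leqn0 cards_eq0 => /eqP ->.
  by exists (fun x => x) => x; rewrite inE.
have [->|[x0 x0X]] := set_0Vmem X; first by exists (fun x => x) => x; rewrite inE.
have [/existsP[S /and4P[SX S0 SnX tight]]|] :=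
  boolP [exists S : {set T}, [&& S \subset X, S != set0, S != X &
           #|nbhd g S| <= #|S|]].
  have SltX : #|S| < #|X| by rewrite proper_card // properEneq SnX.
  have cXS : #|X| = #|S| + #|X :\: S|.
    by rewrite -(cardsID S X) (setIidPr SX).
  have S_gt0 : 0 < #|S| by rewrite card_gt0.
  have [||phi1 inj1 g1] := IHn S g; first lia.
    by move=> S' /subset_trans/(_ SX)/hallX.
  pose g' := [rel x y | g x y && (y \notin nbhd g S)].
  have [||phi2 inj2 g2] := IHn (X :\: S) g'; first lia.
    move=> S' S'X.
    have dS : [disjoint S' & S].
      by move: S'X; rewrite subsetD => /andP[].
    (* Hall's condition for [S'] in [g'] follows from that for the union, since [S] accounts for at
       most [#|S|] of the neighbours. *)
    have /hallX : S' :|: S \subset X.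
      by rewrite subUset SX andbT; apply: subset_trans S'X (subsetDl _ _).
    rewrite cardsU (disjoint_setI0 dS) cards0 subn0 => le1.
    have le2 : #|nbhd g (S' :|: S)| <= #|nbhd g' S'| + #|nbhd g S|.
      apply: leq_trans (leq_card_setU _ _).1.
      apply/subset_leq_card/subsetP => y /nbhdP[x]; rewrite in_setU.
      have [yS|yS] := boolP (y \in nbhd g S); first by rewrite in_setU yS orbT.
      case/orP => [xS' gxy|xS gxy].
        by rewrite in_setU; apply/orP; left; apply/nbhdP; exists x; rewrite //= gxy.
      by case/nbhdP: yS; exists x.
    lia.
  exists (fun x => if x \in S then phi1 x else phi2 x).
    move=> x y xX yX; case: ifPn => xS; case: ifPn => yS.
    - exact: inj1.
    - move=> eqp; have /andP[_ /negP[]] : g' y (phi2 y) by apply: g2; rewrite inE yS.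
      by rewrite -eqp; apply/nbhdP; exists x; rewrite ?g1.
    - move=> eqp; have /andP[_ /negP[]] : g' x (phi2 x) by apply: g2; rewrite inE xS.
      by rewrite eqp; apply/nbhdP; exists y; rewrite ?g1.
    by apply: inj2; rewrite inE ?xS ?yS.
  move=> x xX; case: ifPn => xS; first exact: g1.
  by have /andP[] : g' x (phi2 x) by apply: g2; rewrite inE xS.
move=> /existsPn loose.
have [y0 gxy0] : exists y0, g x0 y0.
  have /hallX : [set x0] \subset X by rewrite sub1set.
  rewrite cards1 card_gt0 => /set0Pn[y /nbhdP[x]]; rewrite inE => /eqP ->.
  by exists y.
(* Nonempty proper subsets now have a spare neighbour, so they can afford to lose [y0]. *)
pose g' := [rel x y | g x y && (y != y0)].
have cX := cardsD1 x0 X; rewrite x0X in cX.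
have [||phi pinj gphi] := IHn (X :\ x0) g'; first lia.
  move=> S SX; have [->|S0] := eqVneq S set0; first by rewrite cards0.
  have := loose S; rewrite S0 (subset_trans SX (subD1set _ _)) /=.
  have -> /= : S != X.
    apply: contraTneq SX => ->; apply/negP => /subsetP/(_ _ x0X).
    by rewrite !inE eqxx.
  have : #|nbhd g S| <= 1 + #|nbhd g' S|.
    rewrite -(cards1 y0); apply: leq_trans (leq_card_setU _ _).1.
    apply/subset_leq_card/subsetP => y /nbhdP[x xS gxy].
    rewrite in_setU in_set1; case: eqVneq => //= yy0.
    by apply/nbhdP; exists x; rewrite //= gxy.
  lia.
exists (fun x => if x == x0 then y0 else phi x).
  move=> x y xX yX; case: (eqVneq x x0) => [->|xx0]; case: (eqVneq y x0) => [->|yx0] //.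
  - have /andP[_ /eqP +] : g' y (phi y) by apply: gphi; rewrite !inE yx0.
    by move=> + eqp; rewrite eqp.
  - have /andP[_ /eqP +] : g' x (phi x) by apply: gphi; rewrite !inE xx0.
    by move=> + eqp; rewrite eqp.
  by apply: pinj; rewrite !inE ?xx0 ?yx0.
move=> x xX; case: eqVneq => [->//|xx0].
by have /andP[] : g' x (phi x) by apply: gphi; rewrite !inE xx0.
Qed.

(* A subset minimal for |N(X)| <= |X| is perfectly matched onto its
   neighbourhood, and removing the matching preserves the hypotheses with
   one less degree.  Iterating, the i-th matching gets colour i; its vertices
   are covered by all earlier ones, so every vertex sees an initial segment. *)
Lemma nested_matchings d g X :
    X != set0 -> {in X, forall x, d <= #|[set y | g x y]|} ->
    #|nbhd g X| <= #|X| ->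
  exists (h : rel T) (c : T -> T -> nat),
  [/\ forall x y, h x y -> x \in X /\ g x y,
      forall x y z, h x y -> h x z -> c x y = c x z -> y = z,
      forall x y z, h x z -> h y z -> c x z = c y z -> x = y,
      (forall x y k, h x y -> k <= c x y -> exists2 z, h x z & c x z = k) /\
      (forall x y k, h x y -> k <= c x y -> exists2 z, h z y & c z y = k) &
      d ^ 2 <= 2 * #|arcs h|].
Proof.
elim: d g X => [|d IHd] g X X0 degX NX.
  by exists (fun _ _ => false), (fun _ _ => 0); split.
pose P (S : {set T}) := [&& S \subset X, S != set0 & #|nbhd g S| <= #|S|].
have /ex_minset[X' /minsetP[/and3P[X'X X'0 NX'] minX']] : exists S, P S.
  by exists X; rewrite /P subxx X0.
have degX' : {in X', forall x, d < #|[set y | g x y]|}.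
  by move=> x /(subsetP X'X)/degX.
have deg_nbhd x : x \in X' -> #|[set y | g x y]| <= #|nbhd g X'|.
  move=> xX'; apply/subset_leq_card/subsetP => y; rewrite inE => gxy.
  by apply/nbhdP; exists x.
have small_S S : S \subset X' -> S != X' -> #|S| <= #|nbhd g S| ?= iff (S == set0).
  move=> SX' SnX'; have [->|S0] := eqVneq S set0.
    split; first by rewrite cards0.
    apply/eqP; rewrite cards0; apply/esym/eqP; rewrite cards_eq0.
    by apply/eqP/setP => y; rewrite [in RHS]inE; apply/nbhdP => -[x]; rewrite inE.
  have: ~~ (#|nbhd g S| <= #|S|).
    apply: contra SnX' => NS; apply/eqP/minX' => //.
    by rewrite /P (subset_trans SX' X'X) S0.
  by rewrite -ltnNge => lt; split; [exact: ltnW | exact: ltn_eqF].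
have leX' : #|X'| <= #|nbhd g X'|.
  have [x xX'] := set0Pn _ X'0.
  have cX' := cardsD1 x X'; rewrite xX' in cX'.
  have sX' : X' :\ x \subset X' by exact: subD1set.
  have nX' : X' :\ x != X'.
    by apply: contraTneq xX' => <-; rewrite !inE eqxx.
  have [->//|] := eqVneq #|X'| 1.
    by apply: leq_trans (deg_nbhd _ xX'); apply: leq_ltn_trans (degX' _ xX').
  (* Without [x] the set is nonempty and proper, so it has strictly more neighbours than elements,
     hence at least [#|X'|] of them. *)
  move=> ne1; have le1 := subset_leq_card (nbhdS g sX').
  have [le2 eq2] := small_S _ sX' nX'.
  have: (X' :\ x == set0) = false by rewrite -cards_eq0; lia.
  rewrite -eq2; lia.
have [S SX'|phi pinj gphi] := @hall g X'.
  by have [->//|nS] := eqVneq S X'; case: (small_S S SX' nS).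
(* The matching covers all of [nbhd g X'], so vertices on the right also see colour 0 whenever they
   meet a later matching. *)
have phi_im : phi @: X' = nbhd g X'.
  apply/eqP; rewrite eqEcard card_in_imset // NX' andbT.
  apply/subsetP => _ /imsetP[x xX' ->]; apply/nbhdP; exists x => //; exact: gphi.
pose g' := [rel x y | [&& x \in X', g x y & y != phi x]].
have g'g x y : g' x y -> g x y by case/and3P.
have [||h [c [hg crow ccol [cdrow cdcol] cnt]]] := IHd g' X' X'0.
- move=> x xX'; rewrite -ltnS; apply: leq_trans (degX' x xX') _.
  rewrite (cardsD1 (phi x)) -[X in _ <= X]add1n leq_add ?leq_b1 //.
  apply/subset_leq_card/subsetP => y; rewrite !inE /= => /andP[-> ->].
  by rewrite xX'.
- apply: leq_trans NX'; apply/subset_leq_card/subsetP => y /nbhdP[x xX' g'xy].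
  by apply/nbhdP; exists x => //; apply: g'g.
pose M x y := (x \in X') && (y == phi x).
have hM x y : h x y -> M x y = false.
  by move=> /hg[xX' /and3P[_ _ /negPf ny]]; rewrite /M ny andbF.
exists (fun x y => M x y || h x y), (fun x y => if M x y then 0 else (c x y).+1).
split.
- move=> x y /orP[/andP[xX' /eqP ->]|/hg[xX' /g'g]].
    by split; [exact: (subsetP X'X) | exact: gphi].
  by split; first exact: (subsetP X'X).
- move=> x y z /orP[Mxy|hxy] /orP[Mxz|hxz].
  + by move: Mxy Mxz => /andP[_ /eqP ->] /andP[_ /eqP ->].
  + by rewrite Mxy hM.
  + by rewrite Mxz hM.
  by rewrite !hM // => -[]; apply: crow.
- move=> x y z /orP[Mxy|hxy] /orP[Mxz|hxz].
  + move: Mxy Mxz => /andP[xX' /eqP ->] /andP[yX' /eqP eqp] _; exact: pinj.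
  + by rewrite Mxy hM.
  + by rewrite Mxz hM.
  by rewrite !hM // => -[]; apply: ccol.
- split=> x y k /orP[Mxy|hxy].
  + by rewrite Mxy leqn0 => /eqP ->; exists y; rewrite ?Mxy.
  + rewrite hM //; case: k => [_|k /(cdrow x y k hxy)[z hxz <-]].
      have [xX' _] := hg _ _ hxy.
      by exists (phi x); rewrite /M xX' eqxx.
    by exists z; rewrite ?hM ?hxz ?orbT.
  + by rewrite Mxy leqn0 => /eqP ->; exists x; rewrite ?Mxy.
  rewrite hM //; case: k => [_|k /(cdcol x y k hxy)[z hxz <-]].
    have [xX' /g'g gxy] := hg _ _ hxy.
    have : y \in phi @: X' by rewrite phi_im; apply/nbhdP; exists x.
    by case/imsetP => z zX' ->; exists z; rewrite /M zX' eqxx.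
  by exists z; rewrite ?hM ?hxz ?orbT.
have cM : #|[set p : T * T | M p.1 p.2]| = #|X'|.
  have <- : (fun x => (x, phi x)) @: X' = [set p : T * T | M p.1 p.2].
    apply/setP => -[x y]; rewrite inE /= /M; apply/imsetP/andP.
      by move=> [z zX' [-> ->]].
    by move=> [xX' /eqP ->]; exists x.
  by rewrite card_imset // => x y [].
(* The new matching has at least [d + 1] edges, and [d ^ 2 + 2 * (d + 1)] exceeds [(d + 1) ^ 2]. *)
have d_lt : d < #|X'|.
  have [x xX'] := set0Pn _ X'0.
  by apply: leq_trans NX'; apply: leq_trans (deg_nbhd _ xX'); apply: degX'.
have -> : arcs (fun x y => M x y || h x y)
    = [set p : T * T | M p.1 p.2] :|: arcs h.
  by apply/setP => p; rewrite !inE.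
rewrite cardsU disjoint_setI0 ?cards0 ?cM ?subn0; first lia.
rewrite disjoint_subset; apply/subsetP => p; rewrite !inE.
by apply: contraTN => /hM ->.
Qed.

(** * Interval colourable subgraphs of dense graphs *)

(** The colours at each vertex, on either side, are closed downwards and so form an initial segment.
    Membership in [A] recovers the orientation in which [c] is read. *)
Lemma bipartite_interval_colourable A h c :
    (forall x y, h x y -> x \in A /\ y \notin A) ->
    (forall x y z, h x y -> h x z -> c x y = c x z -> y = z) ->
    (forall x y z, h x z -> h y z -> c x z = c y z -> x = y) ->
    (forall x y k, h x y -> k <= c x y -> exists2 z, h x z & c x z = k) ->
    (forall x y k, h x y -> k <= c x y -> exists2 z, h z y & c z y = k) ->
  interval_colourable [rel x y | h x y || h y x].
Proof.
move=> hA crow ccol cdrow cdcol.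
exists (fun x y => if x \in A then c x y else c y x).
have hl x y : x \in A -> h y x = false.
  by move=> xA; apply/negP => /hA[_]; rewrite xA.
have hr x y : x \notin A -> h x y = false.
  by move=> /negP xA; apply/negP => /hA[].
split; first split.
- move=> x y /orP[] /hA[] h1 h2; first by rewrite h1 (negPf h2).
  by rewrite h1 (negPf h2).
- move=> v w1 w2 /=; case: ifPn => vA.
    rewrite !(hl v) // !orbF => h1 h2; apply: contraNneq => /crow -> //.
  by rewrite !(hr v) //= => h1 h2; apply: contraNneq => /ccol -> //.
move=> v a b k _ /mem_colours_at[w /= hw wb] /andP[_ kb].
apply/mem_colours_at; move: hw wb; have [vA|vA] /= := boolP (v \in A).
  rewrite (hl v) // orbF => hw wb; rewrite -wb in kb.
  by have [z hz <-] := cdrow _ _ _ hw kb; exists z; rewrite ?hz.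
rewrite (hr v) //= => hw wb; rewrite -wb in kb.
by have [z hz <-] := cdcol _ _ _ hw kb; exists z; rewrite ?hz ?orbT.
Qed.

(* Take a maximum cut of [U]. *)
Lemma halving_bipartition e U : symmetric e -> irreflexive e ->
  exists2 A : {set T}, A \subset U &
    {in A, forall v, #|[set w in U | e v w]| <= 2 * #|[set w in U :\: A | e v w]|}
    /\ {in U :\: A, forall v,
         #|[set w in U | e v w]| <= 2 * #|[set w in A | e v w]|}.
Proof.
move=> eC eirr.
pose cut A := \sum_(x in A) \sum_(y in U :\: A) (e x y : nat).
have degE (v : T) S : #|[set w in S | e v w]| = \sum_(y in S) (e v y : nat).
  rewrite -sum1_card big_mkcond [RHS]big_mkcond; apply: eq_bigr => y _.
  by rewrite inE; case: (y \in S); case: (e v y).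
have cutC A : A \subset U -> cut (U :\: A) = cut A.
  move=> AU; rewrite /cut setDDr setDv set0U (setIidPr AU) exchange_big.
  by apply: eq_bigr => x _; apply: eq_bigr => y _; rewrite eC.
(* Moving [v] out of [A] gains its neighbours in [A] and loses those in [U :\: A]; if the cut does
   not grow, at least half of its neighbours in [U] lie across. *)
have cutD1 A v : A \subset U -> v \in A -> cut (A :\ v) <= cut A ->
    #|[set w in U | e v w]| <= 2 * #|[set w in U :\: A | e v w]|.
  move=> AU vA; have vU := subsetP AU _ vA.
  rewrite /cut (big_setD1 v vA) /=.
  have vB : v \in U :\: (A :\ v) by rewrite !inE eqxx vU.
  have BE : (U :\: (A :\ v)) :\ v = U :\: A.
    apply/setP => x; rewrite !inE; case: (eqVneq x v) => [->|] //=.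
    by rewrite vA.
  under eq_bigr => x _ do rewrite (big_setD1 v vB) /= BE.
  rewrite big_split /= leq_add2r !degE [X in _ -> X <= _](big_setID A) /= (setIidPr AU).
  rewrite [X in _ -> X + _ <= _](big_setD1 v vA) /= eirr add0n.
  under eq_bigr => x _ do rewrite eC.
  lia.
pose A := [arg max_(A > (set0 : {set T}) | A \subset U) cut A].
have [AU Amax] : A \subset U /\ forall B : {set T}, B \subset U -> cut B <= cut A.
  by rewrite /A; case: arg_maxnP => [|B BU Bmax]; rewrite ?sub0set.
exists A => //; split=> v vA.
  by apply: cutD1 => //; apply: Amax; apply: subset_trans AU; apply: subD1set.
(* The other side follows because complementing within [U] preserves the cut. *)
have := @cutD1 (U :\: A) v (subsetDl _ _) vA.
rewrite setDDr setDv set0U (setIidPr AU); apply.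
rewrite (cutC A) //; apply: Amax.
by apply: subset_trans (subsetDl U A); apply: subD1set.
Qed.

(** Some [U] induces minimum degree at least [2 * d], and a maximum cut keeps degree [d] across.
    With [X] the larger side, all neighbours lie in the smaller side [Y], so nested matchings
    apply. *)
Lemma dense_interval_colourable_subgraph e d :
    symmetric e -> irreflexive e -> 0 < d -> ~ degenerate e (2 * d) ->
  exists f : rel T, [/\ symmetric f, forall x y, f x y -> e x y,
    interval_colourable f & d ^ 2 <= 2 * #|arcs f|].
Proof.
move=> eC eirr d0 ndeg.
have [U U0 Udeg] : exists2 U : {set T}, U != set0 &
    {in U, forall v, 2 * d <= #|[set w in U | e v w]|}.
  have [/existsP[U /andP[U0 /forall_inP UP]]|/existsPn nU] :=
    boolP [exists U : {set T}, (U != set0) &&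
      [forall v in U, 2 * d <= #|[set w in U | e v w]|]].
    by exists U.
  case: ndeg => U U0; have := nU U; rewrite U0 /= => /forall_inPn[v vU].
  by rewrite -ltnNge; exists v.
have [A AU [degA degB]] := halving_bipartition U eC eirr.
suff main (X Y : {set T}) : [disjoint X & Y] -> X != set0 -> #|Y| <= #|X| ->
    {in X, forall x, d <= #|[set w in Y | e x w]|} ->
  exists f : rel T, [/\ symmetric f, forall x y, f x y -> e x y,
    interval_colourable f & d ^ 2 <= 2 * #|arcs f|].
  have half n m : 2 * d <= n -> n <= 2 * m -> d <= m by lia.
  have cU : #|U| = #|A| + #|U :\: A| by rewrite -(cardsID A U) (setIidPr AU).
  have U_gt0 : 0 < #|U| by rewrite card_gt0.
  have dAB : [disjoint A & U :\: A].
    by rewrite -setI_eq0; apply/eqP/setP => x; rewrite !inE; case: (x \in A).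
  case: (leqP #|U :\: A| #|A|) => BA.
    apply: main (BA) _; rewrite -?card_gt0 //; first lia.
    by move=> x xA; apply: half (Udeg x (subsetP AU _ xA)) (degA x xA).
  apply: main (ltnW BA) _; rewrite -?card_gt0 1?disjoint_sym //; first lia.
  move=> x xB; apply: half (degB x xB).
  by apply: Udeg; move: xB; rewrite inE => /andP[].
move=> dXY X0 YX degX.
pose g := [rel x y | e x y && (y \in Y)].
have [||h [c [hg crow ccol [cdrow cdcol] cnt]]] := @nested_matchings d g X X0.
- move=> x /degX; congr (_ <= _); apply: eq_card => y.
  by rewrite !inE andbC.
- apply: leq_trans YX; apply/subset_leq_card/subsetP => y.
  by case/nbhdP => x _ /andP[].
exists [rel x y | h x y || h y x]; split.
- by move=> x y /=; rewrite orbC.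
- by move=> x y /orP[] /hg[_ /andP[exy _]] //; rewrite eC.
- apply: bipartite_interval_colourable crow ccol cdrow cdcol => x y /hg.
  by move=> [xX /andP[_ yY]]; split; [exact: xX | rewrite (disjointFl dXY yY)].
apply: leq_trans cnt _; rewrite leq_mul2l; apply/subset_leq_card/subsetP => p.
by rewrite !inE => /= ->.
Qed.

(** * Repeated removal and the cube root bound *)

(** Taking [d = 2 * t], each removal uses one class and at least [2 * t ^ 2] arcs, so at most [r]
    occur; the [4 * t] remaining classes are forests. *)
Lemma icol_partition_of_arcs e t r :
    symmetric e -> irreflexive e -> 0 < t -> #|arcs e| <= r * (2 * t ^ 2) ->
  exists2 k, k <= r + 4 * t & has_icol_partition e k.
Proof.
move=> + + t0; elim: r e => [|r IHr] e eC eirr ce.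
all: have [deg|ndeg] := asbP (degenerate e (2 * (2 * t))).
1,3: by exists (2 * (2 * t));
  [lia | apply: degenerate_icol_partition; rewrite // !muln_gt0].
all: have [|f [fsym fe fcol cf]] := dense_interval_colourable_subgraph eC eirr _ ndeg;
  first lia.
all: have cef := card_arcs_sub fe.
  (* With [r = 0] there are no arcs, whereas a graph that is not degenerate would contain a nonempty
     [f]. *)
  have : 0 < (2 * t) ^ 2 by rewrite expn_gt0; lia.
  lia.
have [|||k kr ek] := IHr [rel x y | e x y && ~~ f x y].
- by move=> x y /=; rewrite eC fsym.
- by move=> x /=; rewrite eirr.
- by move: cf; rewrite expnMn; lia.
by exists k.+1; [lia | apply: has_icol_partitionS ek].
Qed.

(** For the least [t] with [m <= t ^ 3] there are at most [2 * m <= t * (2 * t ^ 2)] arcs, so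
    [5 * t] classes suffice. *)
Lemma thickness_cube e m : simple_graph e -> 0 < m -> #|edge_set e| <= m ->
  thickness e ^ 3 <= 1000 * m.
Proof.
move=> [eC eirr] m0 em.
have ex_t : exists t, m <= t ^ 3 by exists m; rewrite -{1}[m]expn1 leq_pexp2l.
have [t mt tmin] := ex_minnP ex_t.
have t0 : 0 < t by case: (t) mt => //; rewrite leqNgt m0.
have [|k kt /thickness_leq ek] := icol_partition_of_arcs eC eirr t0 (r := t).
  apply: leq_trans (card_arcs_edge_set e) _; move: mt; rewrite !expnS expn0; nia.
have thk : thickness e <= 5 * t by lia.
have : t.-1 ^ 3 < m by rewrite ltnNge; apply/negP => /tmin; lia.
(* Minimality bounds [t.-1] rather than [t]; doubling the constant covers the difference except when
   [t = 1]. *)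
move=> tm; have t2 : 5 * t <= 10 * t.-1 \/ t = 1 by lia.
case: t2 => [t2|t1].
  apply: leq_trans (_ : (10 * t.-1) ^ 3 <= _).
    by rewrite leq_exp2r //; apply: leq_trans t2.
  by rewrite expnMn leq_mul // ltnW.
apply: leq_trans (_ : 5 ^ 3 <= _); first by rewrite leq_exp2r //; lia.
by apply: leq_trans (_ : 1000 * 1 <= _); rewrite // leq_mul2l.
Qed.

End Colourings.

Lemma card_edge_set_leq (T : finType) (e : rel T) : #|edge_set e| <= #|T| ^ 2.
Proof.
rewrite -mulnn -cardX.
apply: leq_trans (leq_imset_card (fun p : T * T => [set p.1; p.2]) _).
apply/subset_leq_card/subsetP => _ /imset2P[x y _ _ ->].
by apply/imsetP; exists (x, y); rewrite ?inE.
Qed.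

(** * Real exponents and the asymptotic bounds *)

Local Open Scope R_scope.

Lemma INR_expn a n : INR (a ^ n)%N = INR a ^ n.
Proof. by elim: n => //= n IHn; rewrite expnS mult_INR IHn. Qed.

Lemma cube_le_inj x y : 0 < y -> x ^ 3 <= y ^ 3 -> x <= y.
Proof.
move=> y0 xy3; case: (Rle_lt_dec x y) => // yx.
have : 0 < (x - y) * (x * x + x * y + y * y) by apply: Rmult_lt_0_compat; nra.
move: xy3; rewrite /=; lra.
Qed.

(** Cube roots give the bound [10 * Rpower x alpha], and the factor 10 is at most [Rpower x (1 / 9)]
    once [x] reaches [10 ^ 9]. *)
Lemma cube_leq_Rpower (a m : nat) (x alpha beta : R) :
    (a ^ 3 <= 1000 * m)%N -> INR m = Rpower x (3 * alpha) ->
    Rpower 10 9 <= x -> alpha + 1 / 9 <= beta ->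
  INR a <= Rpower x beta.
Proof.
move=> am mx x_ge ab.
have R10 : 0 < Rpower 10 9 by apply: exp_pos.
have x1 : 1 < x.
  apply: Rlt_le_trans x_ge; rewrite -(Rpower_O 10); last lra.
  by apply: Rpower_lt; lra.
have ten : 10 <= Rpower x (1 / 9).
  have -> : 10 = Rpower (Rpower 10 9) (1 / 9).
    by rewrite Rpower_mult -{1}(Rpower_1 10); [congr Rpower; lra | lra].
  by apply: Rle_Rpower_l; lra.
have bound : INR a <= 10 * Rpower x alpha.
  have y0 : 0 < Rpower x alpha by apply: exp_pos.
  apply: cube_le_inj; first lra.
  rewrite Rpow_mult_distr -(Rpower_pow 3 (Rpower x alpha)) // Rpower_mult.
  have -> : alpha * INR 3 = 3 * alpha by rewrite /=; lra.
  rewrite -mx -INR_expn.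
  have -> : 10 ^ 3 * INR m = INR (1000 * m)%N.
    by rewrite mult_INR (_ : 1000 = 10 ^ 3)%N // INR_expn; congr (_ ^ _ * _);
      rewrite /=; lra.
  by apply/le_INR/leP.
apply: Rle_trans bound _; apply: Rle_trans (_ : Rpower x (1 / 9 + alpha) <= _).
  rewrite Rpower_plus; apply: Rmult_le_compat_r => //.
  exact/Rlt_le/exp_pos.
by apply: Rle_Rpower; lra.
Qed.

Local Close Scope R_scope.

Theorem theorem1 :
  (forall eps : R, (0 < eps)%R ->
     exists N : nat, forall n : nat, N <= n ->
       forall (T : finType) (e : rel T), simple_graph e -> #|T| = n ->
         (INR (thickness e) <= Rpower (INR n) (5 / 6 + eps))%R)
  /\
  (forall eps : R, (0 < eps)%R ->
     exists M : nat, forall m : nat, M <= m ->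
       forall (T : finType) (e : rel T), simple_graph e -> #|edge_set e| = m ->
         (INR (thickness e) <= Rpower (INR m) (5 / 11 + eps))%R).
Proof.
have R10 : (0 < Rpower 10 9)%R by apply: exp_pos.
have [N N_ge] := INR_unbounded (Rpower 10 9).
have large n : N <= n -> (Rpower 10 9 <= INR n)%R.
  by move=> /leP/le_INR; lra.
have pos n : N <= n -> 0 < n.
  move=> /large; case: n => //= ?; lra.
split=> eps eps0; exists N => n Nn T e eG card_n.
  (* Here [2 / 3 + 1 / 9 = 7 / 9], which is below [5 / 6]. *)
  apply: (cube_leq_Rpower (m := n ^ 2) (alpha := (2 / 3)%R)); last lra.
  - by apply: thickness_cube; rewrite ?expn_gt0 ?pos // -card_n card_edge_set_leq.
  - rewrite INR_expn -Rpower_pow; last by apply/lt_0_INR/ltP/pos.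
    by congr Rpower; rewrite /=; lra.
  - exact: large.
(* Here [1 / 3 + 1 / 9 = 4 / 9], which is just below [5 / 11]. *)
apply: (cube_leq_Rpower (m := n) (alpha := (1 / 3)%R)); last lra.
- by apply: thickness_cube; rewrite ?pos ?card_n.
- rewrite -[LHS]Rpower_1; last by apply/lt_0_INR/ltP/pos.
  by congr Rpower; lra.
- exact: large.
Qed.
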